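(* Let $\Gamma$ be a discrete Euclidean subring of $\mathbb{C}$ containing $1$ and spanning $\mathbb{C}$. Then the set of complex numbers which are well-approximable with respect to $\Gamma$ is totally disconnected.
   Context: The rings $\Gamma$ in question are exactly $\mathbb{Z}[i]$, $\mathbb{Z}[\sqrt{2}\,i]$, $\mathbb{Z}[\frac12(1+\sqrt3\,i)]$, $\mathbb{Z}[\frac12(1+\sqrt7\,i)]$, $\mathbb{Z}[\frac12(1+\sqrt{11}\,i)]$. A complex number $z$ is badly approximable with respect to $\Gamma$ if there exists $\delta>0$ such that $\left|z-\frac pq\right|\ge\delta/|q|^2$ for all $p,q\in\Gamma$ with $q\ne0$. A complex number is well-approximable with respect to $\Gamma$ if it is not badly approximable with respect to $\Gamma$. *)

(* Defs.v *)
From HB Require Import structures.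
From mathcomp Require Import all_boot all_order all_algebra.
From mathcomp Require Import all_classical all_reals all_analysis.
From mathcomp Require Import complex.

Set Implicit Arguments.
Unset Strict Implicit.
Unset Printing Implicit Defensive.

Import Order.TTheory GRing.Theory Num.Theory.
Import numFieldNormedType.Exports.

Local Open Scope classical_set_scope.
Local Open Scope ring_scope.
Local Open Scope complex_scope.

(* The library puts no topology on [R[i]] itself; the usual topology of the
   complex plane, given by the balls of the modulus, is the one of the numeric
   field [R[i]] carried by its alias [R[i]^o]. *)

Definition discrete_subset (R : realType) (G : set R[i]) : Prop :=
  forall x, G x -> isolated (G : set R[i]^o) x.

Definition spans_complex (R : realType) (G : set R[i]) : Prop :=
  forall z : R[i], exists (n : nat) (c : 'I_n -> R) (g : 'I_n -> R[i]),
    (forall k, G (g k)) /\ z = \sum_(k < n) (c k)%:C * g k.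

(* The Euclidean function is arbitrary (not necessarily the squared modulus),
   with values in [nat]; its values at 0 and outside of [G] are irrelevant. A
   subring of a field needs no separate integrality hypothesis. *)
Definition euclidean_subring (R : realType) (G : set R[i]) : Prop :=
  subring_closed (mem G) /\
  exists N : R[i] -> nat, forall a b : R[i], G a -> G b -> b != 0 ->
    exists q r : R[i], [/\ G q, G r, a = b * q + r & r = 0 \/ (N r < N b)%N].

Definition badly_approximable (R : realType) (G : set R[i]) (z : R[i]) : Prop :=
  exists delta : R, 0 < delta /\
    forall p q : R[i], G p -> G q -> q != 0 ->
      delta%:C / `|q| ^+ 2 <= `|z - p / q|.

Definition well_approximable (R : realType) (G : set R[i]) (z : R[i]) : Prop :=
  ~ badly_approximable G z.

(* Main.v *)
(* A positive integer n that is not a norm from the imaginary quadratic field K of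
   fractions of G yields badly approximable circles: if c is in K and
   |z - c|^2 = n (s/t)^2, then for a fraction p/q the number
   |p/q - c|^2 - |z - c|^2 is, up to a bounded denominator times |q|^2, a
   nonzero integer |P|^2 - n |Q|^2, so |z - p/q| >= delta / |q|^2. The centers c
   and the radii are dense, hence any two points are separated by such a circle,
   which avoids the well-approximable numbers. Writing norms as X^2 + D Y^2, such
   an n is a quadratic nonresidue modulo an odd prime dividing the squarefree
   part of D if there is one; otherwise K is Q(i) or Q(sqrt(-2)), where 3 and 5
   respectively are inert. *)

Require Import Defs.
From mathcomp Require Import all_boot all_order all_algebra.
From mathcomp Require Import all_classical all_reals all_analysis.
From mathcomp Require Import complex ring lra zify.
Import Order.TTheory GRing.Theory Num.Theory.
Import numFieldNormedType.Exports.
Import ComplexField.Normc.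
Local Open Scope classical_set_scope.
Local Open Scope ring_scope.
Local Open Scope complex_scope.
Local Notation Re := complex.Re.
Local Notation Im := complex.Im.

(** * Integers that are not norms from an imaginary quadratic field *)

(* For n > 0: n is not a norm from Q(sqrt(-D)). *)
Definition nonnorm (D n : nat) : Prop := forall X Y X' Y' : nat,
  (X ^ 2 + D * Y ^ 2 = n * (X' ^ 2 + D * Y' ^ 2))%N -> X' = 0%N /\ Y' = 0%N.

(** Infinite descent: dividing all four unknowns by [q] gives another solution, with a smaller
    [X' + Y'] unless this sum is already 0. *)
Lemma nonnorm_descent (D n q : nat) : (1 < q)%N ->
  (forall X Y X' Y' : nat,
     (X ^ 2 + D * Y ^ 2 = n * (X' ^ 2 + D * Y' ^ 2))%N ->
     [/\ q %| X, q %| Y, q %| X' & q %| Y']%N) ->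
  nonnorm D n.
Proof.
move=> q1 dvd_all X Y X' Y'; have [m] := ubnP (X' + Y')%N.
elim: m X Y X' Y' => // m IH X Y X' Y' lem eqn.
have [/dvdnP[x eX] /dvdnP[y eY] /dvdnP[x' eX'] /dvdnP[y' eY']] :=
  dvd_all _ _ _ _ eqn.
have [//|gt0] := posnP (X' + Y')%N; first by lia.
have [| |x'0 y'0] := IH x y x' y'; [by nia| |by rewrite eX' eY' x'0 y'0].
have q20 : (0 < q ^ 2)%N by rewrite expn_gt0; lia.
by apply/eqP; rewrite -(eqn_pmul2r q20); apply/eqP; nia.
Qed.

(** The finite check says that [x^2 + D y^2] is anisotropic modulo [q]. So [q] divides [X] and [Y];
    the left side is then divisible by [q^2], which leaves a factor [q] in [X'^2 + D Y'^2]. For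
    concrete [D] and [q] the check is a computation. *)
Lemma nonnorm_inert (D q : nat) : prime q ->
  (all (fun x => all (fun y =>
      (q %| x ^ 2 + D * y ^ 2) ==> (x == 0) && (y == 0))
    (iota 0 q)) (iota 0 q))%N ->
  nonnorm D q.
Proof.
move=> q_pr inert_mod; have inert (X Y : nat) :
    (q %| X ^ 2 + D * Y ^ 2)%N -> ((q %| X) && (q %| Y))%N.
  have mem_mod Z : (Z %% q)%N \in iota 0 q.
    by rewrite mem_iota leq0n ltn_pmod // prime_gt0.
  have /allP/(_ _ (mem_mod X))/allP/(_ _ (mem_mod Y))/implyP := inert_mod.
  move=> mod0 dvd; apply: mod0; move: dvd.
  rewrite /dvdn -[X in _ -> X == _]modnDm modnXm -(modnMmr D ((Y %% q) ^ 2)%N).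
  by rewrite modnXm modnMmr modnDm.
apply: (nonnorm_descent _ _ _ (prime_gt1 q_pr)).
move=> X Y X' Y' eqn; have q0 := prime_gt0 q_pr.
have /andP[dX dY] : ((q %| X) && (q %| Y))%N.
  by apply: inert; rewrite eqn dvdn_mulr.
suff /andP[dX' dY'] : ((q %| X') && (q %| Y'))%N by [].
case/dvdnP: dX dY eqn => x -> /dvdnP[y ->] eqn; apply: inert.
apply/dvdnP; exists (x ^ 2 + D * y ^ 2)%N; apply/eqP.
by rewrite -(eqn_pmul2l q0); apply/eqP; lia.
Qed.

(** Squaring identifies 1 and -1, which differ for odd [p]. Being non-injective on a finite set, it
    is not surjective, and any missed value serves as [a]. *)
Lemma Fp_nonsquare (p : nat) : prime p -> odd p ->
  exists a : 'F_p, forall x y : 'F_p, x ^+ 2 = a * y ^+ 2 -> x = 0 /\ y = 0.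
Proof.
move=> p_pr p_odd.
have [a Ha] : exists a : 'F_p, forall x, x ^+ 2 != a.
  apply: contrapT => /forallNP sq.
  have surj (a : 'F_p) : exists x, x ^+ 2 == a.
    have /existsNP[x /negP] := sq a.
    by rewrite negbK => xa; exists x.
  have /(_ 1 (-1)) : injective (fun x : 'F_p => x ^+ 2).
    suff inj : {in 'F_p &, injective (fun x : 'F_p => x ^+ 2)}.
      by move=> x y; exact: inj.
    apply/image_injP.
    apply/eqP/eq_card => b; have [c /eqP <-] := surj b.
    by rewrite inE; exact: (fintype.image_f (fun x : 'F_p => x ^+ 2)).
  rewrite sqrrN => /(_ erefl)/eqP.
  rewrite -addr_eq0 -mulr2n -(dvdn_pcharf (pchar_Fp p_pr)).
  by rewrite dvdn_prime2 // => /eqP p2; rewrite p2 in p_odd.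
exists a => x y; have [->|y0] := eqVneq y 0.
  by rewrite expr0n mulr0 => /eqP; rewrite expf_eq0 => /eqP.
move=> xy; have /eqP[] := Ha (x / y).
by rewrite expr_div_n xy mulfK // expf_neq0.
Qed.

Lemma nonnorm_ramified (D p : nat) : prime p -> odd p -> (p %| D)%N ->
  ~~ (p ^ 2 %| D)%N -> exists2 n, (0 < n)%N & nonnorm D n.
Proof.
move=> p_pr p_odd /dvdnP[d ->]; rewrite expnS expn1 dvdn_pmul2r ?prime_gt0 //.
have FpE m : (p %| m)%N = (m%:R == 0 :> 'F_p) by exact/dvdn_pcharf/pchar_Fp.
rewrite FpE => d0; have [a aP] := Fp_nonsquare _ p_pr p_odd.
have dvd2 (x y : nat) (m k : nat) :
    (x ^ 2 + p * m = a * y ^ 2 + p * k)%N -> (p %| x)%N /\ (p %| y)%N.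
  have p0 : p%:R = 0 :> 'F_p by exact: pchar_Fp_0.
  move=> /(congr1 (fun i : nat => i%:R : 'F_p)).
  rewrite !natrD (natrM _ a) !natrX !(natrM _ p) p0.
  rewrite !mul0r !addr0 natr_Zp => /aP[x0 y0].
  by split; rewrite FpE ?x0 ?y0.
(* The representative is positive: for [a = 0] the pair (0, 1) would violate [dvd2]. *)
exists (a : nat).
  rewrite lt0n; apply/eqP => a0; have [] := dvd2 0 1%N 0 0; first by rewrite a0.
  by rewrite dvdn1 => _ /eqP p1; rewrite p1 in p_pr.
apply: (nonnorm_descent _ _ _ (prime_gt1 p_pr)) => X Y X' Y' eqn.
have [dX dX'] : (p %| X)%N /\ (p %| X')%N.
  apply: (dvd2 _ _ (d * Y ^ 2)%N (a * d * Y' ^ 2)%N).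
  by transitivity (X ^ 2 + d * p * Y ^ 2)%N; [ring|rewrite eqn; ring].
(* Cancelling [p] leaves [d Y^2] congruent to [a d Y'^2]; multiplying by the unit [d] turns both
   sides into the shape of [dvd2]. *)
suff [] : (p %| d * Y)%N /\ (p %| d * Y')%N.
  by rewrite !FpE !natrM !mulf_eq0 !(negPf d0) /= -!FpE.
case/dvdnP: dX dX' eqn => x -> /dvdnP[x' ->] eqn.
apply: (dvd2 _ _ (d * x ^ 2)%N (a * d * x' ^ 2)%N); apply/eqP.
rewrite -(eqn_pmul2l (prime_gt0 p_pr)); apply/eqP.
transitivity (d * ((x * p) ^ 2 + d * p * Y ^ 2))%N; [ring|rewrite eqn; ring].
Qed.

Lemma exists_nonnorm (D : nat) : (0 < D)%N ->
  exists2 n, (0 < n)%N & nonnorm D n.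
Proof.
have [m] := ubnP D; elim: m D => // m IH D Dm D0.
have [[q [q_pr /dvdnP[d Dd]]]|sqfree] :=
    pselect (exists q, prime q /\ (q ^ 2 %| D)%N).
  have q1 := prime_gt1 q_pr.
  (* A square factor is absorbed into the second unknown: [q^2 d Y^2 = d (q Y)^2]. *)
  have [||n n0 dn] := IH d; [by nia|by nia|].
  exists n => // X Y X' Y' eqn.
  have [|-> /eqP] := dn X (q * Y)%N X' (q * Y')%N; first by nia.
  by rewrite muln_eq0 (gtn_eqF (ltnW q1)) => /eqP ->.
have [[p [p_pr p_odd pD]]|even_pr] :=
    pselect (exists p, [/\ prime p, odd p & (p %| D)%N]).
  apply: (nonnorm_ramified _ p) => //; apply/negP => p2.
  by apply: sqfree; exists p.
(* What remains is squarefree without odd prime factors, so [D] is 1 or 2. *)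
have odd1 d : (d %| D)%N -> odd d -> d = 1%N.
  move=> dD d_odd; have [d_gt1|] := ltnP 1 d; last by case: d dD d_odd => [|[]].
  have [] := even_pr; exists (pdiv d); split; first exact: pdiv_prime.
    exact: dvdn_odd (pdiv_dvd d) d_odd.
  exact: dvdn_trans (pdiv_dvd d) dD.
have [D_odd|D_even] := boolP (odd D).
  rewrite (odd1 D (dvdnn D) D_odd); exists 3%N => //.
  exact: nonnorm_inert.
have Dh : D = (2 * D./2)%N by lia.
have h1 : D./2 = 1%N.
  apply: odd1; first by rewrite {2}Dh dvdn_mull.
  apply/negP => /negP h_even; apply: sqfree; exists 2%N; split => //.
  by apply/dvdnP; exists D./2./2; lia.
rewrite Dh h1; exists 5%N => //; exact: nonnorm_inert.
Qed.

(** * Discrete subrings of the complex plane and their norm forms *)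

Lemma sqr_normc_ReIm (R : realType) (z : R[i]) :
  normc z ^+ 2 = Re z ^+ 2 + Im z ^+ 2.
Proof. by case: z => a b; rewrite sqr_sqrtr // addr_ge0 ?sqr_ge0. Qed.

Lemma normc_ge0 (R : realType) (z : R[i]) : 0 <= normc z.
Proof. by case: z => a b; rewrite sqrtr_ge0. Qed.

Lemma normcX (R : realType) (z : R[i]) n : normc (z ^+ n) = normc z ^+ n.
Proof.
by elim: n => [|n IH]; rewrite ?expr0 ?normc1 // !exprS normcM IH.
Qed.

Lemma subring_closedE (R : realType) (G : set R[i]) :
  subring_closed (mem G) ->
  [/\ G 1, forall x y, G x -> G y -> G (x - y)
    & forall x y, G x -> G y -> G (x * y)].
Proof.
case=> G1 GB GM; split=> [|x y Gx Gy|x y Gx Gy]; apply/set_mem => //.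
  by apply: GB; exact/mem_set.
by apply: GM; exact/mem_set.
Qed.

Lemma subring_int (R : realType) (G : set R[i]) (k : int) :
  subring_closed (mem G) -> G k%:~R.
Proof.
move=> Gring; have [G1 GB _] := subring_closedE _ _ Gring.
have G0 : G 0 by rewrite -(subrr 1); exact: GB.
have GN (n : nat) : G n%:R.
  elim: n => [//|n Gn]; rewrite -natr1 -[X in _ + X]opprK; apply: (GB) => //.
  by rewrite -sub0r; exact: GB.
by case: k => n; rewrite ?NegzE ?mulrNz -?pmulrn // -sub0r; exact: GB.
Qed.

(* The powers of an element of modulus less than 1 accumulate at 0. *)
Lemma discrete_normc_ge1 (R : realType) (G : set R[i]) (z : R[i]) :
  subring_closed (mem G) -> discrete_subset G -> G z -> z != 0 ->
  1 <= normc z.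
Proof.
move=> Gring disc Gz z0; have [G1 GB GM] := subring_closedE _ _ Gring.
have GX n : G (z ^+ n).
  by elim: n => [|n IH]; rewrite ?expr0 ?exprS //; exact: GM.
have G0 : G 0 by rewrite -(subrr 1); exact: GB.
rewrite leNgt; apply/negP => z1.
have [_ [V V0 VG]] := disc 0 G0.
have [e /= e0 eV] : exists2 e : R[i], 0 < e & ball (0 : R[i]^o) e `<=` V.
  by move: V0; rewrite -nbhs_ballE.
have e_gt0 : 0 < Re e by move: e0; rewrite ltcE => /andP[].
have /cvgrPdist_lt/(_ _ e_gt0)[n _ /(_ n (leqnn n))/=] :
    normc z ^+ n @[n --> \oo] --> (0 : R).
  by apply: cvg_expr; rewrite ger0_norm ?normc_ge0.
rewrite sub0r normrN ger0_norm ?exprn_ge0 ?normc_ge0 // -normcX => zn_e.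
have /eqP : [set 0] (z ^+ n).
  rewrite -VG; split=> //; apply: eV; rewrite -ball_normE /= sub0r normrN.
  by rewrite -(RRe_real (gtr0_real e0)) ltcR.
by rewrite expf_eq0 (negPf z0) andbF.
Qed.

Lemma ReIm_int (R : realType) (k : int) :
  Re (k%:~R : R[i]) = k%:~R /\ Im (k%:~R : R[i]) = 0.
Proof. by rewrite -(rmorph_int (real_complex R)). Qed.

Lemma Re_sub (R : realType) (x y : R[i]) : Re (x - y) = Re x - Re y.
Proof. by case: x y => a b [c d]. Qed.

Lemma Im_sub (R : realType) (x y : R[i]) : Im (x - y) = Im x - Im y.
Proof. by case: x y => a b [c d]. Qed.

Lemma Re_mul (R : realType) (x y : R[i]) :
  Re (x * y) = Re x * Re y - Im x * Im y.
Proof. by case: x y => a b [c d]. Qed.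

Lemma Im_mul (R : realType) (x y : R[i]) :
  Im (x * y) = Re x * Im y + Im x * Re y.
Proof. by case: x y => a b [c d]. Qed.

(** Subtracting the nearest integer leaves an element of [G] with real part at most 1/2 and
    imaginary part less than 1/2 in absolute value. Its modulus is below 1, so it vanishes. *)
Lemma discrete_near_real (R : realType) (G : set R[i]) (z : R[i]) :
  subring_closed (mem G) -> discrete_subset G -> G z -> `|Im z| < 2^-1 ->
  exists k : int, z = k%:~R.
Proof.
move=> Gring disc Gz Imz; have [G1 GB GM] := subring_closedE _ _ Gring.
pose k := Num.floor (Re z + 2^-1); exists k.
apply/eqP; rewrite -subr_eq0; apply: contraTT isT => zk0.
have Gzk : G (z - k%:~R) by apply: (GB) => //; exact: subring_int.
have := discrete_normc_ge1 _ _ _ Gring disc Gzk zk0.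
have [Rek Imk] := ReIm_int R k.
have := sqr_normc_ReIm _ (z - k%:~R); rewrite Re_sub Im_sub Rek Imk subr0.
have := floor_itv (Re z + 2^-1); rewrite -/k intrD => /andP[k1 k2].
move: Imz; rewrite ltr_norml => /andP[i1 i2].
nra.
Qed.

(** Elements whose imaginary parts differ by less than 1/2 differ by an integer, hence have equal
    imaginary parts. Each strict decrease is thus at least 1/2, and [m] bounds the number of
    decreases. *)
Lemma discrete_min_Im (R : realType) (G : set R[i]) (z : R[i]) :
  subring_closed (mem G) -> discrete_subset G -> G z -> 0 < Im z ->
  exists w, [/\ G w, 0 < Im w & forall v, G v -> Im v < Im w -> Im v <= 0].
Proof.
move=> Gring disc Gz z0; have [G1 GB GM] := subring_closedE _ _ Gring.
have [m] : exists m : nat, Im z < m%:R / 2.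
  exists (Num.trunc (2 * Im z)).+1; have := truncnS_gt (2 * Im z); lra.
elim: m z Gz z0 => [|m IH] z Gz z0 zm; first lra.
have [[v [Gv v0 vz]]|zmin] :=
    pselect (exists v, [/\ G v, 0 < Im v & Im v < Im z]).
  apply: (IH v) => //; rewrite ltNge; apply/negP => mv.
  have Gzv := GB _ _ Gz Gv.
  have [k /(congr1 (@complex.Im R))] : exists k : int, z - v = k%:~R.
    apply: (discrete_near_real _ _ _ Gring disc) => //.
    by rewrite Im_sub ltr_norml; move: zm; rewrite -natr1; lra.
  by rewrite (ReIm_int R k).2 Im_sub; lra.
exists z; split=> // v Gv vz; rewrite leNgt; apply/negP => v0.
by apply: zmin; exists v.
Qed.

(** For [w] of least positive imaginary part, every element of [G] is [x + y w] with integers [x],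
    [y]. Completing the square gives [4 |x + y w|^2 = (2 x + a y)^2 + D y^2], where [a = 2 Re w] and
    [D = 4 (Im w)^2]. *)
Lemma discrete_subring_norms (R : realType) (G : set R[i]) (z : R[i]) :
  subring_closed (mem G) -> discrete_subset G -> G z -> Im z != 0 ->
  exists2 D : nat, (0 < D)%N & forall v, G v ->
    exists X Y : nat, 4 * normc v ^+ 2 = (X ^ 2 + D * Y ^ 2)%:R.
Proof.
move=> Gring disc Gz z0; have [G1 GB GM] := subring_closedE _ _ Gring.
have Gint k : G k%:~R by exact: subring_int.
have [w [Gw w0 wmin]] :
    exists w, [/\ G w, 0 < Im w & forall v, G v -> Im v < Im w -> Im v <= 0].
  have [z_gt0|z_le0] := ltP 0 (Im z); first exact: discrete_min_Im Gz z_gt0.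
  apply: (discrete_min_Im _ _ (0%:~R - z)) => //; first exact: GB.
  by rewrite Im_sub (ReIm_int R 0).2; move/eqP: z0; lra.
have basis v : G v -> exists x y : int,
    Re v = x%:~R + y%:~R * Re w /\ Im v = y%:~R * Im w.
  (* Reduction by [y w] brings the imaginary part into [[0, Im w)], where minimality forces 0. *)
  move=> Gv; pose y := Num.floor (Im v / Im w).
  have Gu : G (v - y%:~R * w) by apply: (GB) => //; exact: GM.
  have [Rey Imy] := ReIm_int R y.
  have Imu : Im (v - y%:~R * w) = Im v - y%:~R * Im w.
    by rewrite Im_sub Im_mul Rey Imy mul0r addr0.
  have := floor_itv (Im v / Im w); rewrite -/y intrD => /andP[].
  rewrite ler_pdivlMr // ltr_pdivrMr // => y1 y2.
  have Imu0 : Im v - y%:~R * Im w = 0.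
    by have := wmin _ Gu; rewrite Imu; lra.
  have [|x /(congr1 (@complex.Re R))] := discrete_near_real _ _ _ Gring disc Gu.
    by rewrite Imu Imu0 normr0 invr_gt0.
  rewrite Re_sub Re_mul Rey Imy (ReIm_int R x).1 => xE.
  by exists x, y; split; lra.
(* The coordinates of [w^2] give [w^2 = a w + b], so [a] is the trace of [w] and [D] is minus the
   discriminant [a^2 + 4 b]. *)
have [b [a [Reww Imww]]] := basis _ (GM _ _ Gw Gw).
have trw : 2 * Re w = a%:~R.
  apply: (mulIf (lt0r_neq0 w0)); rewrite -Imww Im_mul; ring.
have [D DE] : exists D : nat, 4 * Im w ^+ 2 = D%:R.
  exists `|- (4 * b + a ^+ 2)|%N.
  have DE : 4 * Im w ^+ 2 = (- (4 * b + a ^+ 2))%:~R.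
    move: Reww; rewrite Re_mul rmorphN rmorphD rmorphM rmorphXn /= -trw; nra.
  rewrite DE natr_absz ger0_norm // -(ler0z R) -DE.
  by rewrite mulr_ge0 ?sqr_ge0.
exists D => [|v Gv].
  by rewrite lt0n -(pnatr_eq0 R) -DE mulf_neq0 // expf_neq0 // lt0r_neq0.
have [x [y [vx vy]]] := basis _ Gv.
exists `|(2 * x + y * a)%R|%N, `|y|%N.
have sqr_abs (k : int) : (`|k|%N ^ 2)%:R = k%:~R ^+ 2 :> R.
  by rewrite natrX natr_absz -rmorphXn /= real_normK ?num_real // rmorphXn.
rewrite sqr_normc_ReIm vx vy natrD natrM !sqr_abs -DE rmorphD !rmorphM /= -trw.
ring.
Qed.

(** * Badly approximable circles *)

Lemma normc_gt0 (R : realType) (z : R[i]) : z != 0 -> 0 < normc z.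
Proof.
move=> z0; rewrite lt_neqAle normc_ge0 andbT eq_sym.
by apply: contra z0 => /eqP/eq0_normc ->.
Qed.

Lemma normc_nat (R : realType) (n : nat) : normc (n%:R : R[i]) = n%:R.
Proof.
by rewrite -(rmorph_nat (real_complex R)) /= expr0n addr0 sqrtr_sqr ger0_norm.
Qed.

Lemma normc_distC (R : realType) (x y : R[i]) : normc (x - y) = normc (y - x).
Proof. by rewrite -normcN opprB. Qed.

Lemma normc_triangle (R : realType) (x y z : R[i]) :
  normc (x - z) <= normc (x - y) + normc (y - z).
Proof. by apply: le_trans (le_normcD _ _); rewrite addrA subrK. Qed.

(** After multiplication by 4 the difference is an integer, and it is nonzero because [n] is not a
    norm and [Q] is nonzero. *)
Lemma nonnorm_gap (R : realType) (G : set R[i]) (D n : nat) (P Q : R[i]) :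
  (forall v, G v -> exists X Y : nat,
     4 * normc v ^+ 2 = (X ^ 2 + D * Y ^ 2)%:R) ->
  nonnorm D n -> G P -> G Q -> Q != 0 ->
  1 <= 4 * `|normc P ^+ 2 - n%:R * normc Q ^+ 2|.
Proof.
move=> norms nD GP GQ Q0.
have [X [Y PE]] := norms _ GP; have [X' [Y' QE]] := norms _ GQ.
have ne : (X ^ 2 + D * Y ^ 2 != n * (X' ^ 2 + D * Y' ^ 2))%N.
  apply/eqP => /nD[X'0 Y'0]; have := normc_gt0 _ _ Q0.
  by move: QE; rewrite X'0 Y'0 muln0 addn0; nra.
rewrite -[4]ger0_norm // -normrM mulrBr (mulrCA 4 n%:R) PE QE -natrM.
rewrite !pmulrn -rmorphB /= -intr_norm -[leLHS]/(1%:~R) ler_int.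
by rewrite -gtz0_ge1 normr_gt0 subr_eq0.
Qed.

Lemma circle_badly_approximable (R : realType) (G : set R[i]) (D n s t : nat)
    (u v z : R[i]) :
  subring_closed (mem G) -> discrete_subset G ->
  (forall v, G v -> exists X Y : nat,
     4 * normc v ^+ 2 = (X ^ 2 + D * Y ^ 2)%:R) ->
  nonnorm D n -> (0 < s)%N -> (0 < t)%N -> G u -> G v -> v != 0 ->
  normc (z - u / v) ^+ 2 = n%:R * (s%:R / t%:R) ^+ 2 ->
  badly_approximable G z.
Proof.
move=> Gring disc norms nD s0 t0 Gu Gv v0 circ.
have [G1 GB GM] := subring_closedE _ _ Gring.
have GN (k : nat) : G k%:R by exact: (subring_int _ _ k).
set rho := normc (z - u / v) in circ.
have rho0 : 0 <= rho by exact: normc_ge0.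
(* [A] clears the denominators of center and radius: for [P] and [Q] below, [|P|^2 = A |q|^2 r^2]
   and [n |Q|^2 = A |q|^2 rho^2]. *)
pose A : R := t%:R ^+ 2 * normc v ^+ 2.
have tR : 0 < t%:R :> R by rewrite ltr0n.
have tC : t%:R != 0 :> R[i] by rewrite pnatr_eq0 -lt0n.
have sC : s%:R != 0 :> R[i] by rewrite pnatr_eq0 -lt0n.
have A0 : 0 < A by rewrite mulr_gt0 ?exprn_gt0 // normc_gt0.
(* The entry 1 covers [e >= 1], since [|q| >= 1]. For [e < 1], [|r - rho| <= e] and
   [r + rho <= 2 rho + 1] turn the gap into [1 <= 4 A |q|^2 e (2 rho + 1)]. *)
pose delta := Num.min 1 ((4 * A * (2 * rho + 1))^-1).
have rho1 : 0 < 2 * rho + 1 by rewrite ltr_wpDl // mulr_ge0.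
have A4 : 0 < 4 * A * (2 * rho + 1) by do 2?rewrite mulr_gt0 //.
have delta0 : 0 < delta by rewrite lt_min ltr01 invr_gt0.
exists delta; split=> // p q Gp Gq q0.
have q1 := discrete_normc_ge1 _ _ _ Gring disc Gq q0.
pose e := normc (z - p / q).
suff key : delta / normc q ^+ 2 <= e.
  rewrite -[`|z - p / q|]/((normc (z - p / q))%:C) -[`|q|]/((normc q)%:C).
  by rewrite -rmorphXn -fmorph_div lecR.
rewrite ler_pdivrMr ?exprn_gt0 ?normc_gt0 //.
have q21 : 1 <= normc q ^+ 2 by rewrite exprn_ege1.
have [e1|e1] := leP 1 e.
  have d1 : delta <= 1 by rewrite ge_min lexx.
  nra.
pose r := normc (p / q - u / v).
have r0 : 0 <= r by exact: normc_ge0.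
have r_le : r <= e + rho.
  by rewrite /e normc_distC; exact: normc_triangle.
have rho_le : rho <= e + r by exact: normc_triangle.
have e0 : 0 <= e by exact: normc_ge0.
pose P := t%:R * (p * v - u * q); pose Q := s%:R * (v * q).
have GP : G P by apply: (GM) => //; apply: GB; exact: GM.
have GQ : G Q by do 2?apply: (GM) => //.
have Q0 : Q != 0 by rewrite !mulf_neq0.
have := nonnorm_gap _ _ _ _ _ _ norms nD GP GQ Q0.
have -> : normc P ^+ 2 = A * normc q ^+ 2 * r ^+ 2.
  have -> : P = t%:R * v * q * (p / q - u / v) by rewrite /P; field; rewrite v0.
  by rewrite !normcM normc_nat /A /r; ring.
have -> : n%:R * normc Q ^+ 2 = A * normc q ^+ 2 * rho ^+ 2.
  by rewrite circ !normcM normc_nat /A; field; rewrite lt0r_neq0.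
rewrite -mulrBr normrM (ger0_norm (mulr_ge0 (ltW A0) (ltW _))); last first.
  by rewrite exprn_gt0 // normc_gt0.
have rr : `|r ^+ 2 - rho ^+ 2| <= e * (2 * rho + 1).
  by rewrite ler_norml; apply/andP; split; nra.
move=> gap; apply: (@le_trans _ _ ((4 * A * (2 * rho + 1))^-1)).
  by rewrite ge_min lexx orbT.
rewrite -[leLHS]mul1r ler_pdivrMr //.
apply: (le_trans gap).
have -> : e * normc q ^+ 2 * (4 * A * (2 * rho + 1)) =
          4 * (A * normc q ^+ 2 * (e * (2 * rho + 1))) by ring.
by rewrite ler_pM2l // ler_pM2l // mulr_gt0 ?exprn_gt0 // normc_gt0.
Qed.

(** * Density of the centers and radii *)

(** Rounding the real coordinates of [x] in the basis [1, w] down to multiples of [1/N] costs at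
    most [(1 + |w|) / N]. *)
Lemma fractions_dense (R : realType) (G : set R[i]) (w x : R[i]) (eps : R) :
  subring_closed (mem G) -> G w -> Im w != 0 -> 0 < eps ->
  exists u v, [/\ G u, G v, v != 0 & normc (x - u / v) < eps].
Proof.
move=> Gring Gw w0 eps0; have [G1 GB GM] := subring_closedE _ _ Gring.
have Gint k : G k%:~R by exact: subring_int.
have [alpha [beta xE]] : exists alpha beta : R, x = alpha%:C + beta%:C * w.
  exists (Re x - Im x / Im w * Re w), (Im x / Im w).
  apply/eqP; rewrite eq_complex /=; case: (w) (w0) => a b /= b0.
  by apply/andP; split; apply/eqP; [ring|field].
pose N := (Num.trunc ((1 + normc w) / eps)).+1.
have NC : N%:R != 0 :> R[i] by rewrite pnatr_eq0.
pose a := Num.floor (N%:R * alpha); pose b := Num.floor (N%:R * beta).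
(* The numerator [a + b w] is written as a difference, the form in which closure of [G] is
   available. *)
exists (a%:~R - (- b)%:~R * w), N%:R; split=> //.
- by apply: GB => //; exact: GM.
- exact: (Gint N).
have normcR (k : R) : normc k%:C = `|k| by rewrite /= expr0n addr0 sqrtr_sqr.
have fract (y : R) : `|y - (Num.floor y)%:~R| <= 1.
  have := floor_itv y; rewrite intrD => /andP[y1 y2].
  by rewrite ler_norml; lra.
have -> : x - (a%:~R - (- b)%:~R * w) / N%:R =
    ((N%:R * alpha - a%:~R)%:C + (N%:R * beta - b%:~R)%:C * w) / N%:R.
  rewrite xE !rmorphB !rmorphM !rmorph_int !rmorph_nat rmorphN /=.
  by move: NC => /= NC; field.
rewrite normcM normcV normc_nat ltr_pdivrMr //.
apply: le_lt_trans (le_normcD _ _) _; rewrite normcM !normcR.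
apply: (@le_lt_trans _ _ (1 + 1 * normc w)).
  by rewrite lerD ?ler_wpM2r ?normc_ge0 ?fract.
by rewrite mul1r mulrC -ltr_pdivrMr // truncnS_gt.
Qed.

(** The choice of [t] makes the grid step [k / t] smaller than [b - a], and [m + 1] indexes the
    first grid point beyond [a]. *)
Lemma rational_multiple_between (R : realType) (k a b : R) :
  0 < k -> 0 <= a -> a < b ->
  exists s t : nat, [/\ (0 < s)%N, (0 < t)%N & a < k * (s%:R / t%:R) < b].
Proof.
move=> k0 a0 ab; pose t := (Num.trunc (k / (b - a))).+1.
pose m := Num.trunc (t%:R * a / k); exists m.+1, t; split=> //.
have ba0 : 0 < b - a by rewrite subr_gt0.
have t0 : 0 < t%:R :> R by rewrite ltr0n.
have : k / (b - a) < t%:R by exact: truncnS_gt.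
have /andP[] : m%:R <= t%:R * a / k < m.+1%:R.
  by rewrite truncn_itv // divr_ge0 ?mulr_ge0 // ltW.
rewrite -natr1 mulrA ltr_pdivlMr // ltr_pdivrMr // !ltr_pdivrMr //.
by rewrite ler_pdivlMr //; nra.
Qed.

(** * Separation of points by circles *)

Lemma ball_real_complex (R : realType) (c z : R[i]) (r : R) :
  ball (c : R[i]^o) r%:C z = (normc (c - z) < r) :> Prop.
Proof. by rewrite -ball_normE /= -ltcR. Qed.

Lemma closed_disc (R : realType) (c : R[i]) (r : R) :
  closed ([set z | normc (c - z) <= r] : set R[i]^o).
Proof.
rewrite -[X in closed X]setCK; apply: open_closedC.
rewrite openE => z /= /negP; rewrite -ltNge => rz.
rewrite /interior -nbhs_ballE; exists (normc (c - z) - r)%:C => /=.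
  by rewrite ltcR subr_gt0.
move=> y; rewrite ball_real_complex => yz /=; apply/negP; rewrite -ltNge.
by have := normc_triangle _ c y z; rewrite (normc_distC _ y z); lra.
Qed.

Theorem corollary3p14 (R : realType) (G : set R[i])
    (hEuclid : euclidean_subring G) (hdisc : discrete_subset G)
    (hspan : spans_complex G) :
  totally_disconnected ([set z | well_approximable G z] : set R[i]^o).
Proof.
have [Gring _] := hEuclid.
have [w [Gw w0]] : exists w, G w /\ Im w != 0.
  (* If all of [G] were real, so would be its real span, which contains [i]. *)
  apply: contrapT => /forallNP real_G.
  have [m [c [g [Gg iE]]]] := hspan 'i%C.
  have := congr1 (@complex.Im R) iE.
  suff -> : Im (\sum_(k < m) (c k)%:C * g k) = 0 by move/eqP; rewrite oner_eq0.
  elim/big_ind: _ => // [x y x0 y0|k _].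
    rewrite (_ : x + y = x - (0 - y)); last by rewrite sub0r opprK.
    by rewrite !Im_sub x0 y0 !subr0.
  have /not_andP[//|/negP] := real_G (g k).
  by rewrite negbK Im_mul /= mul0r addr0 => /eqP ->; rewrite mulr0.
have [D D0 norms] := discrete_subring_norms _ _ _ Gring hdisc Gw w0.
have [n n0 nD] := exists_nonnorm _ D0.
move=> x wx; apply/seteqP; split=> [y [C [Cx Cw conn] Cy]|_ ->]; last first.
  exact: connected_component_refl.
apply: contrapT => /eqP; rewrite -subr_eq0 => /normc_gt0 yx0.
(* A center closer to [x] than half the distance is farther than that from [y], which leaves room
   for a radius strictly between. *)
pose eps := normc (y - x) / 2.
have eps0 : 0 < eps by rewrite divr_gt0.
have [u [v [Gu Gv v0 xc]]] := fractions_dense _ _ _ x _ Gring Gw w0 eps0.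
have yc : eps < normc (y - u / v).
  have := normc_triangle _ y (u / v) x.
  by rewrite (normc_distC _ (u / v) x); move: xc; rewrite /eps; lra.
have sqrtn0 : 0 < Num.sqrt n%:R :> R by rewrite sqrtr_gt0 ltr0n.
have [s [t [s0 t0 /andP[xr ry]]]] := rational_multiple_between _ _ _ _ sqrtn0
  (normc_ge0 _ (x - u / v)) (lt_trans xc yc).
set r := Num.sqrt _ * _ in xr ry.
have off z : C z -> normc (z - u / v) != r.
  move=> /Cw wz; apply/eqP => zr; apply: wz.
  apply: (circle_badly_approximable _ _ D n s t u v) => //.
  by rewrite zr exprMn sqr_sqrtr.
(* The circle misses [C], so the open and the closed disc cut out the same part of [C]. This part is
   relatively clopen and contains [x], so by connectedness it is all of [C], although [y] lies
   outside the disc. *)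
suff disc : C `&` ball (u / v : R[i]^o) r%:C = C.
  move: Cy; rewrite -disc => -[_].
  by rewrite ball_real_complex normc_distC; lra.
apply: conn.
- by exists x; split=> //; rewrite ball_real_complex normc_distC.
- by exists (ball (u / v : R[i]^o) r%:C) => //; exact: ball_open.
exists [set z | normc (u / v - z) <= r]; first exact: closed_disc.
apply/seteqP; split=> z [Cz /=]; rewrite ball_real_complex => zr; split=> //=.
  exact: ltW.
by rewrite lt_neqAle zr andbT normc_distC off.
Qed.
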